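(* Let $A$ be a commutative ring. The finite presentation point covering families of $A$ (for the $(Cons^o,Loc^o)$ factorisation system on $CRings^o$) are exactly the families $\{A\to A[a_i^{-1}]\}_{i\in I}$, with $a_i\in A$, such that $1$ is a linear combination of the $a_i$ with coefficients in $A$. As a consequence, all point covering families admit a finite point covering subfamily.
   Context: $CRings$ is the category of commutative unital rings. $Loc$ is the class of localisation maps $A\to A[S^{-1}]$ and $Cons$ the class of conservative maps (maps $u:A\to B$ such that $a$ is invertible iff $u(a)$ is); $(Loc,Cons)$ is a unique factorisation system on $CRings$, viewed as $(Cons^o,Loc^o)$ on the opposite category. A localisation is of finite presentation iff it is (isomorphic to one) of the form $A\to A[a^{-1}]$ with $a\in A$. A ring $K$ is a point if $K\ne 0$ and every non-zero localisation $K\to K[a^{-1}]$ admits a retraction. A point covering family of $A$ is a family $\{A\to A_i\}$ of localisations of finite presentation such that every ring map $A\to K$ with $K$ a point factors through some $A\to A_i$. *)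

(* Defs.v *)
From HB Require Import structures.
From mathcomp Require Import all_boot all_order all_algebra.
Set Implicit Arguments. Unset Strict Implicit. Unset Printing Implicit Defensive.
Import GRing.Theory.
Local Open Scope ring_scope.

(* Commutative unital rings are comPzRingType, so that the zero ring is        *)
(* allowed; GRing.unit is not available at that level.                         *)
Definition invertible (A : comPzRingType) (x : A) : Prop :=
  exists y : A, x * y = 1.

(* B is A[S^-1] with structure map u, by the universal property: u is only     *)
(* determined up to isomorphism under A.  S is an arbitrary subset, not        *)
(* necessarily multiplicative.                                                 *)
Definition localisation_at (A : comPzRingType) (S : A -> Prop)
    (B : comPzRingType) (u : {rmorphism A -> B}) : Prop :=
  (forall s, S s -> invertible (u s)) /\
  forall (C : comPzRingType) (f : {rmorphism A -> C}),
    (forall s, S s -> invertible (f s)) ->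
    exists g : {rmorphism B -> C},
      g \o u =1 f /\
      forall g' : {rmorphism B -> C}, g' \o u =1 f -> g' =1 g.

Definition localisation (A B : comPzRingType) (u : {rmorphism A -> B}) : Prop :=
  exists S : A -> Prop, localisation_at S u.

Definition localisation_away (A : comPzRingType) (a : A)
    (B : comPzRingType) (u : {rmorphism A -> B}) : Prop :=
  localisation_at (fun s => s = a) u.

(* P is A[x_0, ..., x_(n-1)], again by the universal property: {poly A} and    *)
(* {mpoly A[n]} require A to be non-trivial.                                   *)
Definition polynomial_algebra (A : comPzRingType) (n : nat) (P : comPzRingType)
    (iota : {rmorphism A -> P}) (x : 'I_n -> P) : Prop :=
  forall (C : comPzRingType) (f : {rmorphism A -> C}) (c : 'I_n -> C),
    exists g : {rmorphism P -> C},
      (g \o iota =1 f /\ g \o x =1 c) /\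
      forall g' : {rmorphism P -> C},
        g' \o iota =1 f -> g' \o x =1 c -> g' =1 g.

(* B is isomorphic, as an A-algebra, to                                        *)
(* A[x_0, ..., x_(n-1)] / (r_0, ..., r_(m-1)).                                 *)
Definition finite_presentation (A B : comPzRingType)
    (u : {rmorphism A -> B}) : Prop :=
  exists (n : nat) (P : comPzRingType) (iota : {rmorphism A -> P})
         (x : 'I_n -> P) (q : {rmorphism P -> B}) (m : nat) (r : 'I_m -> P),
    [/\ polynomial_algebra iota x,
        q \o iota =1 u,
        forall b : B, exists p : P, q p = b
      & forall p : P,
          q p = 0 <-> exists c : 'I_m -> P, p = \sum_(j < m) c j * r j].

Definition point (K : comPzRingType) : Prop :=
  (1 : K) <> 0 /\
  forall (a : K) (L : comPzRingType) (l : {rmorphism K -> L}),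
    localisation_away a l -> (1 : L) <> 0 ->
    exists r : {rmorphism L -> K}, r \o l =1 id.

Definition point_covering (A : comPzRingType) (I : Type)
    (B : I -> comPzRingType) (u : forall i, {rmorphism A -> B i}) : Prop :=
  (forall i, localisation (u i) /\ finite_presentation (u i)) /\
  forall (K : comPzRingType) (f : {rmorphism A -> K}), point K ->
    exists (i : I) (g : {rmorphism B i -> K}), g \o u i =1 f.

(* Main.v *)
Require Import Defs.
From HB Require Import structures.
From mathcomp Require Import all_boot all_order all_algebra.
From mathcomp Require Import boolp classical_sets ring.
Set Implicit Arguments. Unset Strict Implicit. Unset Printing Implicit Defensive.
Import Defs GRing.Theory.
Local Open Scope quotient_scope.
Local Open Scope ring_scope.

(** The family of the [A[a_i^-1]] is covering exactly when every map [f] from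
[A] to a point makes some [f a_i] invertible, and points are close enough to
fields for this to be the condition that no maximal ideal contains all [a_i].

If the [a_i] lie in a proper ideal, a maximal ideal [M] above it gives a field
[A/M], which is a point ([exists_point]) in which every [a_i] vanishes, hence
none is invertible.  Conversely an element [x] of a point [K] is invertible or
nilpotent: either [K[x^-1]] is zero, and some power of [x] vanishes, or it
retracts onto [K], and the retraction carries the inverse of [x] back to [K]
([point_unit_or_nilpotent]).  As a unit minus a nilpotent is a unit, a finite
sum that is invertible in a point has an invertible term ([point_sum]); applied
to [1 = \sum_i f c_i * f a_i], this singles out an [i] in the finite support of
the combination, so that the finitely many members of that support already
cover.

It remains to see that the finitely presented localisations are exactly the
[A[a^-1]].  On the one hand [A[a^-1]] is [A[X]/(aX - 1)]
([away_finite_presentation]).  On the other hand [A[S^-1]] is the filtered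
colimit of the [A[t^-1]] for [t] a product of elements of [S]; a finitely
presented algebra [B = A[S^-1]] maps to some stage [A[t^-1]] over [A], and
such a map is an isomorphism because both sides are localisations of [A]
([finite_presentation_away]).

All the rings needed are instances of one construction, the ring of fractions
[(A/(R))[S^-1]] for arbitrary subsets [R] and [S] of [A]: localisations are the
case where [R] is empty, quotients the case where [S] is.  Everything used about
a localisation follows from the concrete description of such fractions
([is_fraction_ring]), which is equivalent to the universal property. *)

(** * Generated ideals, generated monoids, invertible elements *)

Inductive ideal_span (A : comPzRingType) (R : A -> Prop) : A -> Prop :=
| ideal_span0 : ideal_span R 0
| ideal_spanD c r x : R r -> ideal_span R x -> ideal_span R (c * r + x).

Inductive products (A : comPzRingType) (S : A -> Prop) : A -> Prop :=
| products1 : products S 1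
| productsM s x : S s -> products S x -> products S (s * x).

Section SpanProducts.
Variables (A : comPzRingType) (R S : A -> Prop).

Lemma ideal_span_gen r : R r -> ideal_span R r.
Proof.
by move=> Rr; rewrite -[r]mul1r -[_ * _]addr0; apply: ideal_spanD => //;
  exact: ideal_span0.
Qed.

Lemma ideal_span_add x y :
  ideal_span R x -> ideal_span R y -> ideal_span R (x + y).
Proof.
by elim=> [|c r {}x Rr _ IH] Ry; rewrite ?add0r -?addrA //; apply/ideal_spanD/IH.
Qed.

Lemma ideal_span_mull c x : ideal_span R x -> ideal_span R (c * x).
Proof.
elim=> [|d r {}x Rr _ IH]; first by rewrite mulr0; exact: ideal_span0.
by rewrite mulrDr mulrA; exact: ideal_spanD.
Qed.

Lemma products_gen s : S s -> products S s.
Proof.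
by move=> Ss; rewrite -[s]mulr1; apply: productsM => //; exact: products1.
Qed.

Lemma products_mul x y : products S x -> products S y -> products S (x * y).
Proof.
by elim=> [|s {}x Ss _ IH] Sy; rewrite ?mul1r -?mulrA //; apply/productsM/IH.
Qed.

Lemma ideal_span_eq0 (C : comPzRingType) (f : {rmorphism A -> C}) x :
  (forall r, R r -> f r = 0) -> ideal_span R x -> f x = 0.
Proof.
move=> fR; elim=> [|c r {}x Rr _ IH]; first exact: rmorph0.
by rewrite rmorphD rmorphM (fR _ Rr) IH mulr0 addr0.
Qed.

End SpanProducts.

Section Invertible.
Variable A : comPzRingType.

Lemma invertible1 : invertible (1 : A).
Proof. by exists 1; rewrite mulr1. Qed.

Lemma invertibleM (x y : A) : invertible x -> invertible y -> invertible (x * y).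
Proof.
by move=> [x' xx'] [y' yy']; exists (x' * y'); rewrite mulrACA xx' yy' mulr1.
Qed.

Lemma invertible_mull (x y : A) : invertible (x * y) -> invertible x.
Proof. by move=> [z xyz]; exists (y * z); rewrite mulrA. Qed.

Lemma invertible_mulr (x y : A) : invertible (x * y) -> invertible y.
Proof. by rewrite mulrC; exact: invertible_mull. Qed.

Lemma invertibleX (x : A) n : invertible x -> invertible (x ^+ n).
Proof.
move=> xU; elim: n => [|n IH]; first by rewrite expr0; exact: invertible1.
by rewrite exprS; exact: invertibleM.
Qed.

Lemma invertible_cancel (x y z : A) : invertible x -> x * y = x * z -> y = z.
Proof.
move=> [x' xx'] xyz; rewrite -[y]mul1r -[z]mul1r -xx'.
by rewrite [x * x']mulrC -!mulrA xyz.
Qed.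

Lemma invertible_eq0 (x y : A) : invertible x -> x * y = 0 -> y = 0.
Proof. by move=> xU xy0; apply: (invertible_cancel xU); rewrite mulr0. Qed.

Lemma invertible_morph (C : comPzRingType) (f : {rmorphism A -> C}) x :
  invertible x -> invertible (f x).
Proof. by move=> [y xy]; exists (f y); rewrite -rmorphM xy rmorph1. Qed.

End Invertible.

Lemma invertible_products (A C : comPzRingType) (f : {rmorphism A -> C})
    (S : A -> Prop) x :
  (forall s, S s -> invertible (f s)) -> products S x -> invertible (f x).
Proof.
move=> fS; elim=> [|s {}x Ss _ IH]; first by rewrite rmorph1; exact: invertible1.
by rewrite rmorphM; apply: invertibleM => //; exact: fS.
Qed.

(** * Factoring a map through fractions *)

(** The value of the factorisation at [x = iota a / iota s] has to be
[f a / f s]; it depends only on [x] as [f] kills the kernel of [iota].  With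
[s = 1] throughout this is factorisation through a quotient, and with [iota]
a localisation it is the universal property of fractions. *)
Lemma factor_fractions (A F C : comPzRingType) (iota : {rmorphism A -> F})
    (f : {rmorphism A -> C}) :
  (forall x, exists a s, iota s * x = iota a /\ invertible (f s)) ->
  (forall a, iota a = 0 -> f a = 0) ->
  exists g : {rmorphism F -> C}, g \o iota =1 f.
Proof.
move=> frac ker.
(* Allowing every denominator, not only those that f inverts, makes the value
   y usable with any fraction that represents x. *)
have ex x : exists y, forall a s, iota s * x = iota a -> f s * y = f a.
  have [a [s [sx [t st]]]] := frac x; exists (t * f a) => b r rx.
  have : f (r * a - s * b) = 0.
    by apply: ker; rewrite rmorphB !rmorphM -sx -rx; ring.
  rewrite rmorphB !rmorphM => /eqP; rewrite subr_eq0 => /eqP rasb.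
  by rewrite mulrCA rasb mulrA [t * _]mulrC st mul1r.
pose g x := projT1 (cid (ex x)).
have gP x a s : iota s * x = iota a -> f s * g x = f a.
  by rewrite /g; case: cid => y /= /[apply].
have gE x y a s :
    iota s * x = iota a -> invertible (f s) -> f s * y = f a -> g x = y.
  by move=> sx sU sy; apply: (invertible_cancel sU); rewrite (gP _ _ _ sx).
have gB : zmod_morphism g.
  move=> x y; have [a [s [sx sU]]] := frac x.
  have [b [t [ty tU]]] := frac y.
  apply: (@gE _ _ (a * t - s * b) (s * t)).
  - by rewrite rmorphB !rmorphM -sx -ty; ring.
  - by rewrite rmorphM; exact: invertibleM.
  - by rewrite rmorphB !rmorphM -(gP _ _ _ sx) -(gP _ _ _ ty); ring.
have gM : monoid_morphism g.
  split.
    by apply: (@gE _ _ 1 1); rewrite ?rmorph1 ?mulr1 //; exact: invertible1.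
  move=> x y; have [a [s [sx sU]]] := frac x.
  have [b [t [ty tU]]] := frac y.
  apply: (@gE _ _ (a * b) (s * t)).
  - by rewrite !rmorphM -sx -ty; ring.
  - by rewrite rmorphM; exact: invertibleM.
  - by rewrite !rmorphM -(gP _ _ _ sx) -(gP _ _ _ ty); ring.
pose gA := GRing.isZmodMorphism.Build F C g gB.
pose gR := GRing.isMonoidMorphism.Build F C g gM.
pose g' : {rmorphism F -> C} := HB.pack g gA gR.
exists g' => a /=.
by apply: (@gE _ _ a 1); rewrite ?rmorph1 ?mul1r //; exact: invertible1.
Qed.

(** * Fractions over a quotient ring *)

Section FractionsOverQuotient.
Variables (A : comPzRingType) (R S : A -> Prop).

Definition denominator := {s : A | `[< products S s >]}.
Definition prefrac := (A * denominator)%type.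
HB.instance Definition _ := Choice.on denominator.
HB.instance Definition _ := Choice.on prefrac.
Implicit Types x y z : prefrac.

Definition mkden s (Ss : products S s) : denominator := exist _ s (asboolT Ss).

Lemma denP (s : denominator) : products S (val s).
Proof. by apply/asboolP; exact: (valP s). Qed.

Definition den1 : denominator := mkden (products1 S).
Definition denM (s t : denominator) : denominator :=
  mkden (products_mul (denP s) (denP t)).

(** The factor [v] is what makes this relation transitive when the denominators
are allowed to be zero divisors modulo the ideal. *)
Definition prefrac_eq x y : bool :=
  `[< exists2 v, products S v &
        ideal_span R (v * (x.1 * val y.2 - y.1 * val x.2)) >].

Lemma prefrac_eq_refl : reflexive prefrac_eq.
Proof.
move=> x; apply/asboolP; exists 1; first exact: products1.
by rewrite subrr mulr0; exact: ideal_span0.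
Qed.

Lemma prefrac_eq_sym : symmetric prefrac_eq.
Proof.
suff sym x y : prefrac_eq x y -> prefrac_eq y x.
  by move=> x y; apply/idP/idP; exact: sym.
move=> /asboolP[v Sv Rv]; apply/asboolP; exists v => //.
by rewrite (_ : _ * _ = -1 * (v * (x.1 * val y.2 - y.1 * val x.2)));
  [exact: ideal_span_mull | ring].
Qed.

Lemma prefrac_eq_trans : transitive prefrac_eq.
Proof.
move=> y x z /asboolP[v Sv Rv] /asboolP[w Sw Rw]; apply/asboolP.
exists (v * w * val y.2).
  by apply: products_mul (denP _); exact: products_mul.
rewrite (_ : _ * _ = w * val z.2 * (v * (x.1 * val y.2 - y.1 * val x.2))
    + v * val x.2 * (w * (y.1 * val z.2 - z.1 * val y.2)));
  last by move=> /=; ring.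
by apply: ideal_span_add; exact: ideal_span_mull.
Qed.

Canonical prefrac_equiv :=
  EquivRel prefrac_eq prefrac_eq_refl prefrac_eq_sym prefrac_eq_trans.

Definition frac_quot := {eq_quot prefrac_eq}.
HB.instance Definition _ : EqQuotient _ prefrac_eq frac_quot :=
  EqQuotient.on frac_quot.
HB.instance Definition _ := Choice.on frac_quot.

Lemma frac_eq x y :
  \pi_frac_quot x = \pi_frac_quot y <->
  exists2 v, products S v & ideal_span R (v * (x.1 * val y.2 - y.1 * val x.2)).
Proof. by split=> [/eqmodP/asboolP | ?] //; apply/eqmodP/asboolP. Qed.

Lemma repr_frac x :
  exists2 v, products S v &
    ideal_span R (v * ((repr (\pi_frac_quot x)).1 * val x.2
                       - x.1 * val (repr (\pi_frac_quot x)).2)).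
Proof. by apply/frac_eq; rewrite reprK. Qed.

Lemma frac_eq1 x y :
  x.1 * val y.2 = y.1 * val x.2 -> \pi_frac_quot x = \pi_frac_quot y.
Proof.
move=> xy; apply/frac_eq; exists 1; first exact: products1.
by rewrite xy subrr mulr0; exact: ideal_span0.
Qed.

Definition addp x y : prefrac :=
  (x.1 * val y.2 + y.1 * val x.2, denM x.2 y.2).
Definition oppp x : prefrac := (- x.1, x.2).
Definition mulp x y : prefrac := (x.1 * y.1, denM x.2 y.2).

Definition addf := lift_op2 frac_quot addp.
Definition oppf := lift_op1 frac_quot oppp.
Definition mulf := lift_op2 frac_quot mulp.

Lemma pi_addf : {morph \pi_frac_quot : x y / addp x y >-> addf x y}.
Proof.
move=> x y; unlock addf; apply/frac_eq.
have [v Sv Rv] := repr_frac x; have [w Sw Rw] := repr_frac y.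
move: (repr (\pi_frac_quot x)) (repr (\pi_frac_quot y)) Rv Rw => x' y' Rv Rw.
exists (v * w); first exact: products_mul.
rewrite /= (_ : _ * _ =
   - w * val y.2 * val y'.2 * (v * (x'.1 * val x.2 - x.1 * val x'.2))
   + - v * val x.2 * val x'.2 * (w * (y'.1 * val y.2 - y.1 * val y'.2)));
  last by move=> /=; ring.
by apply: ideal_span_add; exact: ideal_span_mull.
Qed.
Canonical pi_addf_morph := PiMorph2 pi_addf.

Lemma pi_oppf : {morph \pi_frac_quot : x / oppp x >-> oppf x}.
Proof.
move=> x; unlock oppf; apply/frac_eq.
have [v Sv Rv] := repr_frac x; exists v => //=.
move: (repr _) Rv => x' Rv.
rewrite (_ : _ * _ = v * (x'.1 * val x.2 - x.1 * val x'.2)) //=; ring.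
Qed.
Canonical pi_oppf_morph := PiMorph1 pi_oppf.

Lemma pi_mulf : {morph \pi_frac_quot : x y / mulp x y >-> mulf x y}.
Proof.
move=> x y; unlock mulf; apply/frac_eq.
have [v Sv Rv] := repr_frac x; have [w Sw Rw] := repr_frac y.
move: (repr (\pi_frac_quot x)) (repr (\pi_frac_quot y)) Rv Rw => x' y' Rv Rw.
exists (v * w); first exact: products_mul.
rewrite /= (_ : _ * _ =
   - w * y.1 * val y'.2 * (v * (x'.1 * val x.2 - x.1 * val x'.2))
   + - v * x'.1 * val x.2 * (w * (y'.1 * val y.2 - y.1 * val y'.2)));
  last by move=> /=; ring.
by apply: ideal_span_add; exact: ideal_span_mull.
Qed.
Canonical pi_mulf_morph := PiMorph2 pi_mulf.

Definition to_frac a : frac_quot := \pi_frac_quot (a, den1).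

Lemma addfA : associative addf.
Proof.
by elim/quotW=> x; elim/quotW=> y; elim/quotW=> z; rewrite !piE;
  apply: frac_eq1 => /=; ring.
Qed.
Lemma addfC : commutative addf.
Proof.
by elim/quotW=> x; elim/quotW=> y; rewrite !piE; apply: frac_eq1 => /=; ring.
Qed.
Lemma add0f : left_id (to_frac 0) addf.
Proof.
by elim/quotW=> x; rewrite /to_frac !piE; apply: frac_eq1 => /=; ring.
Qed.
Lemma addNf : left_inverse (to_frac 0) oppf addf.
Proof.
by elim/quotW=> x; rewrite /to_frac !piE; apply: frac_eq1 => /=; ring.
Qed.
Lemma mulfA : associative mulf.
Proof.
by elim/quotW=> x; elim/quotW=> y; elim/quotW=> z; rewrite !piE;
  apply: frac_eq1 => /=; ring.
Qed.
Lemma mulfC : commutative mulf.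
Proof.
by elim/quotW=> x; elim/quotW=> y; rewrite !piE; apply: frac_eq1 => /=; ring.
Qed.
Lemma mul1f : left_id (to_frac 1) mulf.
Proof.
by elim/quotW=> x; rewrite /to_frac !piE; apply: frac_eq1 => /=; ring.
Qed.
Lemma mulfDl : left_distributive mulf addf.
Proof.
by elim/quotW=> x; elim/quotW=> y; elim/quotW=> z; rewrite !piE;
  apply: frac_eq1 => /=; ring.
Qed.

HB.instance Definition _ :=
  GRing.isZmodule.Build frac_quot addfA addfC add0f addNf.
HB.instance Definition _ :=
  GRing.Zmodule_isComPzRing.Build frac_quot mulfA mulfC mul1f mulfDl.

Lemma to_frac_zmod : zmod_morphism to_frac.
Proof.
by move=> a b; rewrite /to_frac /= [RHS]piE; apply: frac_eq1 => /=; ring.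
Qed.
Lemma to_frac_monoid : monoid_morphism to_frac.
Proof.
by split=> // a b; rewrite /to_frac [RHS]piE; apply: frac_eq1 => /=; ring.
Qed.
HB.instance Definition _ :=
  GRing.isZmodMorphism.Build A frac_quot to_frac to_frac_zmod.
HB.instance Definition _ :=
  GRing.isMonoidMorphism.Build A frac_quot to_frac to_frac_monoid.

Lemma to_frac_eq0 a :
  to_frac a = 0 <-> exists2 v, products S v & ideal_span R (v * a).
Proof.
have E v : v * (a * val den1 - 0 * val den1) = v * a by rewrite /=; ring.
split=> [/frac_eq[v Sv] | [v Sv Rv]]; last by apply/frac_eq; exists v; rewrite ?E.
by rewrite E; exists v.
Qed.

Lemma to_frac_inv s : products S s -> invertible (to_frac s).
Proof.
move=> Ss; exists (\pi_frac_quot (1, mkden Ss)).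
by rewrite /to_frac [LHS]piE; apply: frac_eq1 => /=; ring.
Qed.

Lemma to_frac_surj (x : frac_quot) :
  exists a s, products S s /\ to_frac s * x = to_frac a.
Proof.
elim/quotW: x => -[a s]; exists a, (val s); split; first exact: denP.
by rewrite /to_frac [LHS]piE; apply: frac_eq1 => /=; ring.
Qed.

End FractionsOverQuotient.

(** * Localisations as rings of fractions *)

(** The usual elementwise description of the [A]-algebra [A[S^-1]]. *)
Definition is_fraction_ring (A : comPzRingType) (S : A -> Prop)
    (B : comPzRingType) (u : {rmorphism A -> B}) : Prop :=
  [/\ forall s, S s -> invertible (u s),
      forall b, exists a s, products S s /\ u s * b = u a
    & forall a, u a = 0 -> exists2 s, products S s & s * a = 0].

Definition empty_subset (A : comPzRingType) (x : A) : Prop := False.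

Lemma ideal_span_empty (A : comPzRingType) (x : A) :
  ideal_span (@empty_subset A) x -> x = 0.
Proof. by case. Qed.

Lemma frac_is_fraction_ring (A : comPzRingType) (S : A -> Prop) :
  is_fraction_ring S (to_frac (@empty_subset A) S).
Proof.
split=> [s Ss | b | a /to_frac_eq0[v Sv /ideal_span_empty va0]].
- exact/to_frac_inv/products_gen.
- exact: to_frac_surj.
- by exists v.
Qed.

Lemma fraction_ring_localisation (A : comPzRingType) (S : A -> Prop)
    (B : comPzRingType) (u : {rmorphism A -> B}) :
  is_fraction_ring S u -> localisation_at S u.
Proof.
move=> [uS uF uK]; split=> // C f fS.
have inv s : products S s -> invertible (f s) by exact: invertible_products.
have [b | a ua0 | g gu] := @factor_fractions _ _ _ u f.
- by have [a [s [Ss sb]]] := uF b; exists a, s; split=> //; exact: inv.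
- have [s Ss sa0] := uK _ ua0; apply: (invertible_eq0 (inv _ Ss)).
  by rewrite -rmorphM sa0 rmorph0.
exists g; split=> // g' g'u b; have [a [s [Ss sb]]] := uF b.
apply: (invertible_cancel (inv _ Ss)).
by rewrite -{1}(g'u s) -(gu s) /= -!rmorphM sb; rewrite [LHS]g'u [RHS]gu.
Qed.

(** The uniqueness half of the universal property, applied to [h] and the
identity: a localisation is an epimorphism of rings. *)
Lemma localisation_endo (A : comPzRingType) (S : A -> Prop) (B : comPzRingType)
    (u : {rmorphism A -> B}) (h : {rmorphism B -> B}) :
  localisation_at S u -> h \o u =1 u -> h =1 id.
Proof.
move=> [uS uU] hu b; have [g [_ gU]] := uU B u uS.
by rewrite (gU h hu) -(gU idfun).
Qed.

(** Once [u] inverts [T] there are maps over [A] both ways, and the composite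
[B -> F -> B] is the identity.  Hence the fractions that describe [F] describe
[B] too: an equation in [F] can be read back in [B]. *)
Lemma localisation_transfer (A : comPzRingType) (S T : A -> Prop)
    (B F : comPzRingType) (u : {rmorphism A -> B}) (l : {rmorphism A -> F})
    (e : {rmorphism B -> F}) :
    localisation_at S u -> is_fraction_ring T l -> e \o u =1 l ->
    (forall t, T t -> invertible (u t)) ->
  is_fraction_ring T u.
Proof.
move=> locu fracl eu uT; have [lT lF lK] := fracl.
have [h [hl _]] := (fraction_ring_localisation fracl).2 B u uT.
have he : (h \o e : {rmorphism B -> B}) =1 id.
  by apply: (localisation_endo locu) => a /=; rewrite [e (u a)]eu [LHS]hl.
split=> // [b | a ua0]; last by apply: lK; rewrite -[l a]eu /= ua0 rmorph0.
have [a [s [Ts sb]]] := lF (e b); exists a, s; split=> //.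
by rewrite -(he b) -[u s]hl -[u a]hl /= -rmorphM sb.
Qed.

Lemma localisation_fraction_ring (A : comPzRingType) (S : A -> Prop)
    (B : comPzRingType) (u : {rmorphism A -> B}) :
  localisation_at S u -> is_fraction_ring S u.
Proof.
move=> locu; have fracF := frac_is_fraction_ring S; have [FS _ _] := fracF.
have [e [eu _]] := locu.2 _ (to_frac (@empty_subset A) S) FS.
exact: (localisation_transfer locu fracF eu locu.1).
Qed.

Lemma products_away (A : comPzRingType) (t x : A) :
  products (fun s => s = t) x -> exists n, x = t ^+ n.
Proof.
elim=> [|s {}x -> _ [n ->]]; first by exists 0%N; rewrite expr0.
by exists n.+1; rewrite exprS.
Qed.

(** * Points *)

(** Both cases come from the ring [K[x^-1]]: it vanishes iff [x] is nilpotent,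
and otherwise retracts onto [K]. *)
Lemma point_unit_or_nilpotent (K : comPzRingType) (x : K) :
  point K -> invertible x \/ exists n, x ^+ n = 0.
Proof.
move=> [_ retr]; pose S (s : K) := s = x; pose l := to_frac (@empty_subset K) S.
have fracl : is_fraction_ring S l by exact: frac_is_fraction_ring.
have [L0 | L1] := pselect ((1 : frac_quot (@empty_subset K) S) = 0).
- right; have [_ _ lK] := fracl.
  have [|s /products_away[n ->]] := lK 1; first by rewrite rmorph1.
  by rewrite mulr1; exists n.
- left; have [r rl] := retr x _ l (fraction_ring_localisation fracl) L1.
  by have [lx _ _] := fracl; rewrite -[x]rl; exact: invertible_morph (lx x erefl).
Qed.

(** Points are local rings: if the head of the sum is not invertible then it is
nilpotent, and removing it leaves an invertible sum. *)
Lemma point_sum (K : comPzRingType) (I : eqType) (s : seq I) (F : I -> K) :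
  point K -> invertible (\sum_(i <- s) F i) ->
  exists2 i, i \in s & invertible (F i).
Proof.
move=> ptK; elim: s => [|i s IH].
  by rewrite big_nil => -[y]; rewrite mul0r => /esym; case: ptK.
rewrite big_cons => sumU.
have [iU | [n Fn0]] := point_unit_or_nilpotent (F i) ptK.
  by exists i => //; rewrite mem_head.
have [|j js jU] := IH; last by exists j => //; rewrite in_cons js orbT.
move: sumU; set y := \sum_(j <- s) F j => sumU.
(* y = w - F i divides w ^+ n - F i ^+ n = w ^+ n, where w is the whole sum. *)
have := invertibleX n sumU; rewrite -[_ ^+ n]subr0 -{}Fn0 subrXX.
by rewrite addrAC subrr add0r => /invertible_mull.
Qed.

Lemma field_point (K : comPzRingType) :
  (1 : K) <> 0 -> (forall x : K, x = 0 \/ invertible x) -> point K.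
Proof.
move=> K1 field; split=> // a L l [la lU] L1.
have aU : invertible a.
  have [a0|//] := field a; have [y] := la a erefl.
  by rewrite a0 rmorph0 mul0r => /esym.
have [|r [rl _]] := lU K idfun; first by move=> _ ->.
by exists r.
Qed.

(** Zorn's lemma, applied to sets of generators instead of ideals: membership of
[1] in the generated ideal involves finitely many generators, so it passes to a
member of the chain.  The ideal is the one generated by [M]. *)
Lemma exists_maximal_ideal (A : comPzRingType) (R : A -> Prop) :
  ~ ideal_span R 1 ->
  exists M : A -> Prop, [/\ forall r, R r -> M r, ~ ideal_span M 1
    & forall a, ~ M a -> exists c m, ideal_span M m /\ 1 = c * a + m].
Proof.
move=> R1; pose add (N : set A) a := R a \/ N a.
(* R is built into the predicate: the union of the empty chain must satisfy it. *)
have [F FP Ftot | N [N1 Nmax]] :=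
    Zorn_bigcup (P := [set N | ~ ideal_span (add N) 1]%classic).
  suff chain x : ideal_span (add (\bigcup_(X in F) X)%classic) x ->
      ideal_span R x \/ exists2 X, F X & ideal_span (add X) x.
    by move=> /chain[// | [X /FP]].
  have sub X Y z :
      (X `<=` Y)%classic -> ideal_span (add X) z -> ideal_span (add Y) z.
    move=> XY; elim=> [|c r {}z XR _ IH]; first exact: ideal_span0.
    by apply: ideal_spanD => //; case: XR; [left | right; exact: XY].
  have subR Y z : ideal_span R z -> ideal_span (add Y) z.
    elim=> [|c r {}z XR _ IH]; first exact: ideal_span0.
    by apply: ideal_spanD => //; left.
  elim=> [|c r {}x [Rr | [X FX Xr]] _ [Rx | [Y FY Yx]]].
  - by left; exact: ideal_span0.
  - by left; exact: ideal_spanD.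
  - by right; exists Y => //; apply: ideal_spanD => //; left.
  - by right; exists X => //; apply: ideal_spanD; [right | exact: subR].
  - right; have [XY | YX] := Ftot _ _ FX FY.
      by exists Y => //; apply: ideal_spanD => //; right; exact: XY.
    by exists X => //; apply: ideal_spanD; [right | exact: sub Yx].
exists (add N); split=> // [r Rr | a Na]; first by left.
have [|span1] := pselect (ideal_span (add (N `|` [set a])%classic) 1); last first.
  case: (Nmax _ _ span1); split; first by move=> z; left.
  by move=> /(_ a (or_intror erefl)) ?; apply: Na; right.
have: forall x, ideal_span (add (N `|` [set a])%classic) x ->
    exists c m, ideal_span (add N) m /\ x = c * a + m; last by move=> /[apply].
move=> x; elim=> [|c r {}x rN _ [d [m [Nm ->]]]].
  by exists 0, 0; split; [exact: ideal_span0 | rewrite mul0r addr0].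
have [Nr | ->] : add N r \/ r = a.
  by case: rN => [|[|]]; [left; left | left; right | right].
  by exists d, (c * r + m); split; [exact: ideal_spanD | rewrite addrCA].
by exists (c + d), m; split=> //; rewrite mulrDl addrA.
Qed.

(** The residue field of a maximal ideal containing [R]. *)
Lemma exists_point (A : comPzRingType) (R : A -> Prop) :
  ~ ideal_span R 1 ->
  exists (K : comPzRingType) (f : {rmorphism A -> K}),
    point K /\ forall r, R r -> f r = 0.
Proof.
move=> /exists_maximal_ideal[M [RM M1 Mmax]].
have prod1 x : products (@empty_subset A) x -> x = 1 by case.
have f0 a : to_frac M (@empty_subset A) a = 0 <-> ideal_span M a.
  split=> [/to_frac_eq0[v /prod1->] | Ma]; first by rewrite mul1r.
  by apply/to_frac_eq0; exists 1; [exact: products1 | rewrite mul1r].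
exists (frac_quot M (@empty_subset A)), (to_frac M (@empty_subset A)).
split; last first.
  by move=> r Rr; apply/f0/ideal_span_gen/RM.
apply: field_point => [K1 | x]; first by apply: M1; apply/f0; rewrite rmorph1.
have [a [s [/prod1->]]] := to_frac_surj x; rewrite rmorph1 mul1r => ->.
have [Ma | /Mmax[c [m [/f0 m0 E]]]] := pselect (M a).
  by left; apply/f0/ideal_span_gen.
right; exists (to_frac M (@empty_subset A) c).
have := congr1 (to_frac M (@empty_subset A)) E.
by rewrite rmorph1 rmorphD rmorphM /= m0 addr0 mulrC => <-.
Qed.

(** Coefficients are indexed by [I], not by positions in [s], so an index that
occurs a second time must have its coefficients added up: the induction keeps
[s] duplicate free. *)
Lemma ideal_span_family (A : comPzRingType) (I : Type) (a : I -> A) x :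
  ideal_span (fun r => exists i, r = a i) x ->
  exists (s : seq I) (c : I -> A), x = \sum_(i <- s) c i * a i.
Proof.
suff: ideal_span (fun r => exists i, r = a i) x ->
    exists (s : seq {classic I}) (c : {classic I} -> A),
      uniq s /\ x = \sum_(i <- s) c i * a i.
  by move=> /[apply] -[s [c [_ ->]]]; exists s, c.
elim=> [|d _ {}x [i' ->] _ [s [c [us ->]]]].
  by exists [::], (fun=> 0); rewrite big_nil.
pose i : {classic I} := i'; rewrite -[i']/i; have [si | si] := boolP (i \in s).
- exists s, (fun j => if j == i then d + c j else c j); split=> //.
  rewrite (bigD1_seq i) //= [in RHS](bigD1_seq i) //= eqxx mulrDl addrA.
  by congr (_ + _); apply: eq_bigr => j /negbTE->.
- exists (i :: s : seq {classic I}), (fun j => if j == i then d else c j).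
  split; first by rewrite /= si.
  rewrite big_cons eqxx; congr (_ + _); apply: eq_big_seq => j js.
  by case: eqP si => // <-; rewrite js.
Qed.

(** * Localisations away from an element are finitely presented *)

(** [{poly A}] takes its coefficients in a [comNzRingType]; an equality of
structures, rather than an isomorphism, lets a proof substitute one for [A]. *)
Lemma comNzRing_of_nontrivial (A : comPzRingType) :
  (1 : A) <> 0 -> exists A' : comNzRingType, A = A'.
Proof.
case: A => T cT; set A := GRing.ComPzRing.Pack cT => /eqP A1.
exists (HB.pack T cT (GRing.PzSemiRing_isNonZero.Build A A1) : comNzRingType).
by rewrite {}/A in A1 *; case: cT A1.
Qed.

Lemma trivial_ring_eq (A : comPzRingType) (x y : A) : (1 : A) = 0 -> x = y.
Proof. by move=> A0; rewrite -[x]mul1r -[y]mul1r A0 !mul0r. Qed.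

(** Evaluation at [c].  The target may be the zero ring, where the evaluation
map is the zero map. *)
Lemma horner_factor (A : comNzRingType) (C : comPzRingType)
    (f : {rmorphism A -> C}) (c : C) :
  exists g : {rmorphism {poly A} -> C}, g \o polyC =1 f /\ g 'X = c.
Proof.
have [C0 | /comNzRing_of_nontrivial[C' CC']] := pselect ((1 : C) = 0).
  pose z (p : {poly A}) : C := 0.
  have zB : zmod_morphism z by move=> p q; exact: trivial_ring_eq.
  have zM : monoid_morphism z by split=> [|p q]; exact: trivial_ring_eq.
  pose zA := GRing.isZmodMorphism.Build {poly A} C z zB.
  pose zR := GRing.isMonoidMorphism.Build {poly A} C z zM.
  exists (HB.pack z zA zR : {rmorphism {poly A} -> C}).
  by split=> [a|]; exact: trivial_ring_eq.
subst C; have cfc : commr_rmorph f c by move=> a; exact: mulrC.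
exists (horner_morph cfc : {rmorphism {poly A} -> C'}).
by split=> [a|]; [exact: horner_morphC | exact: horner_morphX].
Qed.

Lemma poly_morph_eq (A : comNzRingType) (C : comPzRingType)
    (g h : {rmorphism {poly A} -> C}) :
  (forall a, g a%:P = h a%:P) -> g 'X = h 'X -> g =1 h.
Proof.
move=> ghC ghX p; elim/poly_ind: p => [|p a IH]; first by rewrite !rmorph0.
by rewrite !rmorphD !rmorphM /= IH ghX ghC.
Qed.

Lemma poly_polynomial_algebra (A : comNzRingType) :
  polynomial_algebra (@polyC A) (fun _ : 'I_1 => 'X).
Proof.
move=> C f c; have [g [gC gX]] := horner_factor f (c ord0).
exists g; split=> [|h hC hX]; first by split=> // i /=; rewrite gX [i]ord1.
apply: poly_morph_eq => [a|]; first by rewrite [LHS]hC [RHS]gC.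
by rewrite gX -(hX ord0).
Qed.

(** [B] is compared with [A[X]/(aX - 1)]: the universal properties give maps [g]
and [h] over [A] in the two directions.  Since [g \o q] is the projection, the
kernel of [q] is the ideal [(aX - 1)]; since [h \o g] is the identity, [q] is
onto. *)
Lemma away_presentation (A : comNzRingType) (a : A) (B : comPzRingType)
    (u : {rmorphism A -> B}) :
  localisation_away a u -> finite_presentation u.
Proof.
move=> locu; have [/(_ a erefl)[b ab] uU] := locu.
have [q [qC qX]] := horner_factor u b.
pose r : {poly A} := a%:P * 'X - 1; pose R := fun p => p = r.
have q0 p : R p -> q p = 0.
  by move=> ->; rewrite rmorphB rmorphM rmorph1 qX [q a%:P]qC ab subrr.
pose pr : {rmorphism {poly A} -> _} := to_frac R (@empty_subset {poly A}).
have prod1 x : products (@empty_subset {poly A}) x -> x = 1 by case.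
have pr0 p : pr p = 0 -> ideal_span R p.
  by move=> /to_frac_eq0[v /prod1->]; rewrite mul1r.
have prr : pr r = 0.
  apply/to_frac_eq0; exists 1; first exact: products1.
  by rewrite mul1r; exact: ideal_span_gen.
have praX : pr a%:P * pr 'X = 1.
  apply/eqP; rewrite -subr_eq0.
  by move: prr; rewrite /r rmorphB rmorphM rmorph1 => ->.
have [|g [gu _]] := uU _ (pr \o @polyC A); first by move=> _ ->; exists (pr 'X).
(* Both sides send 'X to the inverse of the image of a. *)
have gq : (g \o q : {rmorphism _ -> _}) =1 pr.
  apply: poly_morph_eq => [c|] /=; first by rewrite [q _]qC [LHS]gu.
  apply: (@invertible_cancel _ (pr a%:P)); first by exists (pr 'X).
  by rewrite praX qX -[pr a%:P]gu /= -rmorphM ab rmorph1.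
have [|p /pr0 Rp|h hpr] := @factor_fractions _ _ _ pr q.
- move=> x; have [p [s [/prod1-> sx]]] := to_frac_surj x.
  by exists p, 1; split=> //; rewrite rmorph1; exact: invertible1.
- exact: ideal_span_eq0 q0 Rp.
have hg : (h \o g : {rmorphism B -> B}) =1 id.
  apply: (localisation_endo locu) => c /=.
  by rewrite [g (u c)]gu [LHS]hpr [LHS]qC.
exists 1%N, {poly A}, (@polyC A), (fun=> 'X), q, 1%N, (fun=> r).
split=> // [|y|p]; first exact: poly_polynomial_algebra.
  have [p [s [/prod1-> sx]]] := to_frac_surj (g y); exists p.
  by rewrite -(hg y) -[q p]hpr /= -sx rmorph1 mul1r.
split=> [qp0 | [c ->]]; last first.
  by rewrite big_ord1 rmorphM (q0 r erefl) mulr0.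
have : ideal_span R p by apply: pr0; rewrite -gq /= qp0 rmorph0.
elim=> [|c _ x -> _ [d ->]]; first by exists (fun=> 0); rewrite big_ord1 mul0r.
by exists (fun i => c + d i); rewrite !big_ord1 mulrDl.
Qed.

(** If [A] is the zero ring then so is [B], and [A] itself presents it, without
variables or relations. *)
Lemma away_finite_presentation (A : comPzRingType) (a : A) (B : comPzRingType)
    (u : {rmorphism A -> B}) :
  localisation_away a u -> finite_presentation u.
Proof.
have [A0 _ | /comNzRing_of_nontrivial[A' AA']] := pselect ((1 : A) = 0); last first.
  by subst A; exact: away_presentation.
have B0 : (1 : B) = 0 by rewrite -(rmorph1 u) A0 rmorph0.
exists 0%N, A, idfun, (fun=> 0), u, 0%N, (fun=> 0); split=> // [C f c | b | p].
- by exists f; split=> [|g gf _]; [split=> // -[] | exact: gf].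
- by exists 0; exact: trivial_ring_eq.
- split=> _; last exact: trivial_ring_eq.
  by exists (fun=> 0); exact: trivial_ring_eq.
Qed.

(** * Finitely presented localisations invert one element *)

Section LocAway.
Variables (A : comPzRingType) (t : A).

Definition away_ring : comPzRingType :=
  frac_quot (@empty_subset A) (fun s => s = t).

Definition loc_away : {rmorphism A -> away_ring} :=
  to_frac (@empty_subset A) (fun s => s = t).

Lemma loc_away_fraction_ring : is_fraction_ring (fun s => s = t) loc_away.
Proof. exact: frac_is_fraction_ring. Qed.

Lemma loc_away_inv : invertible (loc_away t).
Proof. by have [lt _ _] := loc_away_fraction_ring; exact: lt. Qed.

Lemma loc_away_factor (C : comPzRingType) (f : {rmorphism A -> C}) :
  invertible (f t) -> exists g : {rmorphism away_ring -> C}, g \o loc_away =1 f.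
Proof.
move=> ft; have [_ /(_ C f)[|g [gf _]]] :=
    fraction_ring_localisation loc_away_fraction_ring.
  by move=> _ ->.
by exists g.
Qed.

End LocAway.

(** The generators and relations are lifted to a stage [A[t^-1]] of the colimit
[B = A[S^-1]].  The finitely many generators are fractions with a common
denominator [t0], so they lift to [A[t0^-1]]; the finitely many relations hold
in [B], so each of them is killed there by some further element [v j] of the
monoid, and all of them hold in [A[t^-1]] for [t = t0 * \prod_j v j]. *)
Lemma finite_presentation_away (A : comPzRingType) (B : comPzRingType)
    (u : {rmorphism A -> B}) :
  localisation u -> finite_presentation u -> exists a, localisation_away a u.
Proof.
move=> [S locu] [n [P [iota [x [q [m [r [polyP qu qsurj qker]]]]]]]].
have [uS uF uK] := localisation_fraction_ring locu.
have inv s : products S s -> invertible (u s) by exact: invertible_products.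
have prodS N (t : 'I_N -> A) :
    (forall k, products S (t k)) -> products S (\prod_k t k).
  by move=> St; elim/big_ind: _ => //; [exact: products1 | exact: products_mul].
have invprod N (t : 'I_N -> A) (C : comPzRingType) (f : {rmorphism A -> C}) k :
    invertible (f (\prod_k t k)) -> invertible (f (t k)).
  by rewrite (bigD1 k) //= rmorphM => /invertible_mull.
have Finv := @loc_away_inv A; pose F := @loc_away A.
have /choice[as_ asP] k :
    exists a_s : A * A, products S a_s.2 /\ u a_s.2 * q (x k) = u a_s.1.
  by have [a [s ?]] := uF (q (x k)); exists (a, s).
pose t0 := \prod_k (as_ k).2.
have St0 : products S t0 by apply: prodS => k; case: (asP k).
have /choice[y yP] k : exists y, F t0 (as_ k).2 * y = F t0 (as_ k).1.
  have [z sz] := invprod _ _ _ _ k (Finv t0).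
  by exists (z * F t0 (as_ k).1); rewrite mulrA sz mul1r.
have [g0 [[g0C g0x] _]] := polyP _ (F t0) y.
have [h0 h0F] := loc_away_factor (inv _ St0).
(* Two maps out of P that agree on A and on the variables. *)
have h0g0 : (h0 \o g0 : {rmorphism _ -> _}) =1 q.
  have [g [_ gU]] := polyP _ u (q \o x).
  move=> p; rewrite (gU q qu) //; apply: gU => [a | k] /=.
    by rewrite [g0 _]g0C [LHS]h0F.
  have [Ss sx] := asP k; apply: (invertible_cancel (inv _ Ss)).
  by rewrite sx [g0 _]g0x -[u _]h0F -[u _ in RHS]h0F /= -rmorphM yP.
(* v j is stated by its effect on later stages: a map from A[t0^-1] that inverts
   v j kills the relation r j. *)
have /choice[v vP] j : exists v, products S v /\
    forall (C : comPzRingType) (f : {rmorphism away_ring t0 -> C}),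
      invertible (f (F t0 v)) -> f (g0 (r j)) = 0.
  have [_ /(_ (g0 (r j)))[b [s [ss sb]]] _] := loc_away_fraction_ring t0.
  have [|v Sv vb0] := uK b.
    rewrite -[u b]h0F /= -sb rmorphM [h0 (g0 _)]h0g0 (_ : q _ = 0) ?mulr0 //.
    apply/qker; exists (fun i => (i == j)%:R).
    rewrite (bigD1 j) //= eqxx mul1r big1 ?addr0 // => i /negbTE->.
    by rewrite mul0r.
  exists v; split=> // C f fv; apply: (invertible_eq0 fv).
  have fs : invertible (f (F t0 s)).
    apply/invertible_morph.
    by apply: invertible_products ss => _ ->; exact: Finv.
  apply: (invertible_eq0 fs); rewrite -!rmorphM mulrCA sb -rmorphM.
  by rewrite vb0 !rmorph0.
pose t := t0 * \prod_j v j.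
have St : products S t.
  by apply: products_mul => //; apply: prodS => j; case: (vP j).
have Ft : invertible (F t (t0 * \prod_j v j)) by exact: Finv.
have Ftt0 : invertible (F t t0).
  by move: Ft; rewrite (rmorphM (F t)) => /invertible_mull.
have Ftv j : invertible (F t (v j)).
  by move: Ft; rewrite (rmorphM (F t)) => /invertible_mulr/invprod; apply.
have [f fF] := loc_away_factor Ftt0.
have fr j : f (g0 (r j)) = 0.
  by apply: (vP j).2; rewrite [f _]fF; exact: Ftv.
have [b|p /qker[c ->]|e eq] := @factor_fractions _ _ _ q (f \o g0).
- have [p pb] := qsurj b; exists p, 1; rewrite !rmorph1 mul1r; split=> //.
  exact: invertible1.
- by rewrite raddf_sum big1 // => j _ /=; rewrite !rmorphM fr mulr0.
exists t; apply: fraction_ring_localisation.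
apply: (localisation_transfer (e := e) locu (loc_away_fraction_ring t)) =>
  [a | _ ->]; last exact: inv.
by rewrite /= -[u a]qu /= [LHS]eq /= [g0 _]g0C [LHS]fF.
Qed.

(** * Point covering families *)

Section Coverings.
Variables (A : comPzRingType) (I : Type) (B : I -> comPzRingType).
Variable u : forall i, {rmorphism A -> B i}.

(** If the [a_i] generate a proper ideal, some map to a point kills them all, but
by the covering property it factors through one of the [A[a_i^-1]]. *)
Lemma point_covering_combination :
  point_covering u ->
  exists a : I -> A,
    (forall i, localisation_away (a i) (u i)) /\
    exists (s : seq I) (c : I -> A), 1 = \sum_(i <- s) c i * a i.
Proof.
move=> [locfp cover].
have /choice[a locu] i : exists a, localisation_away a (u i).
  by have [] := locfp i; exact: finite_presentation_away.
exists a; split=> //; apply: ideal_span_family; apply: contrapT => /exists_point.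
move=> [K [f [ptK f0]]]; have [i [g gf]] := cover K f ptK.
have [/(_ _ erefl) uaU _] := locu i.
have := invertible_morph g uaU; rewrite [g _]gf f0; last by exists i.
by move=> [y]; rewrite mul0r => /esym; case: ptK.
Qed.

Lemma point_covering_away (a : I -> A) :
    (forall i, localisation_away (a i) (u i)) ->
    (forall (K : comPzRingType) (f : {rmorphism A -> K}),
      point K -> exists i, invertible (f (a i))) ->
  point_covering u.
Proof.
move=> locu cover; split=> [i | K f /(cover K f)[i fai]].
  split; last exact: away_finite_presentation (locu i).
  by exists (fun s => s = a i); exact: locu.
have [_ /(_ K f)[|g [gf _]]] := locu i; first by move=> _ ->.
by exists i, g.
Qed.

End Coverings.

Lemma combination_invertible (A : comPzRingType) (I : eqType) (s : seq I)
    (c a : I -> A) (K : comPzRingType) (f : {rmorphism A -> K}) :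
  1 = \sum_(i <- s) c i * a i -> point K ->
  exists2 i, i \in s & invertible (f (a i)).
Proof.
move=> E /point_sum ptK.
have /ptK[i si fci] : invertible (\sum_(i <- s) f (c i) * f (a i)).
  have := rmorph1 f; rewrite E rmorph_sum (eq_bigr (fun i => f (c i) * f (a i))).
    by move=> ->; exact: invertible1.
  by move=> i _; rewrite rmorphM.
by exists i => //; exact: invertible_mulr fci.
Qed.

Theorem proposition56 (A : comPzRingType) :
  (forall (I : Type) (B : I -> comPzRingType)
          (u : forall i, {rmorphism A -> B i}),
      point_covering u <->
      exists a : I -> A,
        (forall i, localisation_away (a i) (u i)) /\
        exists (s : seq I) (c : I -> A), 1 = \sum_(i <- s) c i * a i) /\
  (forall (I : Type) (B : I -> comPzRingType)
          (u : forall i, {rmorphism A -> B i}),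
      point_covering u ->
      exists (n : nat) (j : 'I_n -> I),
        injective j /\ point_covering (fun k => u (j k))).
Proof.
split=> I B u.
  split=> [|[a [locu [s [c E]]]]]; first exact: point_covering_combination.
  apply: (point_covering_away locu) => K f ptK.
  by have [i _ fai] := @combination_invertible A {classic I} s c a K f E ptK;
    exists i.
move=> /point_covering_combination[a [locu [s [c E]]]].
pose s' : seq {classic I} := undup (s : seq {classic I}).
pose j := tnth (in_tuple s').
have jinj : injective j by apply/tuple_uniqP/undup_uniq.
exists (size s'), j; split=> //.
apply: (point_covering_away (a := a \o j)) => [k | K f ptK]; first exact: locu.
have [i si fai] := @combination_invertible A {classic I} s c a K f E ptK.
have /(tnthP (in_tuple s'))[k ik] : i \in in_tuple s' by rewrite mem_undup.
by exists k; rewrite /= /j -ik.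
Qed.
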